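(* The family of operators $Z_3=Z_3(A_0,A_1,A_2,A_3)$ admits a shift operator for every even shift $$(A_0,A_1,A_2,A_3)\to(A_0+n_0,A_1+n_1,A_2+n_2,A_3+n_3),\qquad n_0,\dots,n_3\in\mathbb{Z},\quad n_0+n_1+n_2+n_3\in2\mathbb{Z}.$$
   Context: Let $\partial=d/dx$ and $D=\mathbb{C}(x)[\partial]$. $Z_3(A_0,A_1,A_2,A_3)=x^2(x-1)^2\partial^3+p_2\partial^2+p_1\partial+p_0$, where $$\begin{aligned}p_2&=x(2x-1)(x-1)(3+2A_2),\\ p_1&=(5A_2^2-A_3^2+12A_2+7)x^2+(A_0^2-A_1^2-5A_2^2+A_3^2-12A_2-7)x-(A_0+1+A_2)(A_0-1-A_2),\\ p_0&=(2A_2+1)(-A_3+A_2+1)(A_3+A_2+1)x+(2A_2+1)(A_0^2-A_1^2-A_2^2+A_3^2-2A_2-1)/2.\end{aligned}$$ Its local exponents are $0,-A_0-A_2,A_0-A_2$ at $x=0$; $0,-A_1-A_2,A_1-A_2$ at $x=1$; $2A_2+1,A_3+A_2+1,-A_3+A_2+1$ at $x=\infty$. Shift operators: let $E(p)$ be a family of third-order operators depending on parameters $p$, irreducible for generic $p$, and let $p\to p_+$ be a shift of the parameters by integers. A shift operator for this shift is a non-zero operator $P\in D$ of order lower than $3$, depending on $p$, sending the solution space of $E(p)$ to the solution space of $E(p_+)$; equivalently, there is $Q\in D$ with $E(p_+)\circ P=Q\circ E(p)$. The parameters are regarded as generic (indeterminates); the coefficients of $P$ are rational functions of $x$ and of $p$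 (poles in $x$ are allowed; after normalization they may be taken polynomial in $p$ without common factor). *)

(* Defs.v *)
From HB Require Import structures.
From mathcomp Require Import all_boot all_order all_algebra.
From mathcomp Require Import generic_quotient fraction ring.
From mathcomp Require Import complex reals mpoly.

Set Implicit Arguments.
Unset Strict Implicit.
Unset Printing Implicit Defensive.

Import GRing.Theory.
Local Open Scope ring_scope.
Local Open Scope quotient_scope.

(* An operator a_0 + a_1 d + ... + a_n d^n with coefficients in F is encoded
   by the polynomial with coefficients a_i: 'X stands for d. Only the F-module
   structure of {poly F} is meaningful; the product of operators is [dcomp]
   below, not the product of polynomials. *)
Definition diffop (F : fieldType) := {poly F}.

Section DiffOp.
Variables (F : fieldType) (der : F -> F).
Implicit Types (P Q E : diffop F) (f : F).

(* d o Q, by the rule d o a = a d + a' *)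
Definition dleft Q : diffop F := Q * 'X + map_poly der Q.

Definition dcomp P Q : diffop F := \sum_(i < size P) P`_i *: iter i dleft Q.

Definition dapply P f : F := \sum_(i < size P) P`_i * iter i der f.

(* Meaningful for P != 0. *)
Definition dorder P : nat := (size P).-1.

(* E = E(p) and Ep = E(p_+) are members of a family of third-order operators. *)
Definition shift_operator E Ep P : Prop :=
  [/\ P != 0, (dorder P < 3)%N & exists Q, dcomp Ep P = dcomp Q E].

Hypothesis derD : forall f g, der (f + g) = der f + der g.
Hypothesis derM : forall f g, der (f * g) = der f * g + f * der g.

Let der0 : der 0 = 0.
Proof. by apply: (@addrI _ (der 0)); rewrite -derD !addr0. Qed.

Let dapplyE n P f : (size P <= n)%N ->
  dapply P f = \sum_(i < n) P`_i * iter i der f.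
Proof.
move=> le; rewrite /dapply (big_ord_widen _ (fun i => P`_i * iter i der f) le).
rewrite big_mkcond /=; apply: eq_bigr => i _; case: ltnP => // h.
by rewrite nth_default // mul0r.
Qed.

Let dapplyD P Q f : dapply (P + Q) f = dapply P f + dapply Q f.
Proof.
rewrite (dapplyE _ (size_polyD P Q)) (dapplyE _ (leq_maxl (size P) (size Q))).
rewrite (dapplyE _ (leq_maxr (size P) (size Q))) -big_split /=.
by apply: eq_bigr => i _; rewrite coefD mulrDl.
Qed.

Let dapplyZ a P f : dapply (a *: P) f = a * dapply P f.
Proof.
rewrite (dapplyE _ (size_scale_leq a P)) mulr_sumr.
by apply: eq_bigr => i _; rewrite coefZ mulrA.
Qed.

Let dapply_left Q f : dapply (dleft Q) f = der (dapply Q f).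
Proof.
have sz : (size (map_poly der Q) <= size Q)%N.
  by rewrite /map_poly; exact: size_poly.
have szX : (size (Q * 'X)%R <= (size Q).+1)%N.
  by rewrite (leq_trans (size_polyMleq _ _)) // size_polyX addn2.
rewrite dapplyD (dapplyE _ sz) (dapplyE _ szX).
rewrite big_ord_recl /= coefMX /= mul0r add0r -big_split /=.
rewrite [in RHS]/dapply [RHS](big_morph der derD der0).
apply: eq_bigr => i _; rewrite coefMX derM.
by rewrite (coef_map_id0 _ _ der0) addrC.
Qed.

Lemma dapply_comp P Q f : dapply (dcomp P Q) f = dapply P (dapply Q f).
Proof.
have d0 : dapply 0 f = 0 by rewrite /dapply size_poly0 big_ord0.
rewrite /dcomp (big_morph (dapply^~ f) (fun P Q => dapplyD P Q f) d0).
apply: eq_bigr => i _; rewrite dapplyZ; congr (_ * _).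
by elim: (nat_of_ord i) => //= k <-; rewrite dapply_left.
Qed.

End DiffOp.

Section RatFun.
Variable K : fieldType.

Definition ratfun : fieldType := {fraction {poly K}}.

Definition rderiv (f : ratfun) : ratfun :=
  let p := \n_(repr f) in let q := \d_(repr f) in
  tofrac (p^`() * q - p * q^`()) / tofrac q ^+ 2.

Definition ratX : ratfun := tofrac 'X.

Definition ratC (c : K) : ratfun := tofrac c%:P.

Let fracE (f : ratfun) : f = tofrac \n_(repr f) / tofrac \d_(repr f).
Proof.
rewrite [RHS](_ : _ =
  FracField.mul (tofrac \n_(repr f)) (FracField.inv (tofrac \d_(repr f)))) //.
rewrite -[LHS]reprK !piE; apply/eqmodP.
rewrite /= FracField.equivfE /FracField.mulf /FracField.invf.
have d0 := denom_ratioP (repr f); have o0 := oner_neq0 {poly K}.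
rewrite !(numer_Ratio _ o0) !(denom_Ratio _ o0).
rewrite (numer_Ratio _ d0) (denom_Ratio _ d0).
have d1 : 1 * \d_(repr f) != 0 by rewrite mul1r.
by rewrite (numer_Ratio _ d1) (denom_Ratio _ d1) mul1r mulr1 mulrC.
Qed.

Lemma rderiv_frac (p q : {poly K}) : q != 0 ->
  rderiv (tofrac p / tofrac q) =
  tofrac (p^`() * q - p * q^`()) / tofrac q ^+ 2.
Proof.
move=> q0; have := fracE (tofrac p / tofrac q).
rewrite /rderiv; move: (denom_ratioP (repr (tofrac p / tofrac q))).
move: (\n_ _) (\d_ _) => p1 q1 q10 /eqP.
have tq0 : tofrac q != 0 by rewrite tofrac_eq0.
have tq10 : tofrac q1 != 0 by rewrite tofrac_eq0.
rewrite (eqr_div _ _ tq0 tq10) -!tofracM tofrac_eq => /eqP e.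
have e' : p^`() * q1 + p * q1^`() = p1^`() * q + p1 * q^`().
  by rewrite -!derivM e.
apply/eqP; rewrite (eqr_div _ _ (expf_neq0 2 tq10) (expf_neq0 2 tq0)).
rewrite -!tofracXn -!tofracM tofrac_eq -subr_eq0; apply/eqP.
have -> : (p1^`() * q1 - p1 * q1^`()) * q ^+ 2
                - (p^`() * q - p * q^`()) * q1 ^+ 2 =
   q * q1 * (p1^`() * q + p1 * q^`() - (p^`() * q1 + p * q1^`()))
   - (q * q1^`() + q1 * q^`()) * (p1 * q - p * q1)
   + 0 by ring.
by rewrite e e' !subrr !mulr0 subrr addr0.
Qed.

Let ratfunP (f : ratfun) :
  exists p q : {poly K}, q != 0 /\ f = tofrac p / tofrac q.
Proof.
by exists (\n_(repr f)), (\d_(repr f)); split;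
  [exact: denom_ratioP | exact: fracE].
Qed.

Let quot_addE (F : fieldType) (p q r s p' q' r' s' : F) :
  q != 0 -> s != 0 ->
  ((p' * s + p * s' + (r' * q + r * q')) * (q * s) -
   (p * s + r * q) * (q' * s + q * s')) / (q * s) ^+ 2 =
  (p' * q - p * q') / q ^+ 2 + (r' * s - r * s') / s ^+ 2.
Proof. by move=> q0 s0; field; rewrite q0 s0. Qed.

Let quot_mulE (F : fieldType) (p q r s p' q' r' s' : F) :
  q != 0 -> s != 0 ->
  ((p' * r + p * r') * (q * s) - p * r * (q' * s + q * s')) / (q * s) ^+ 2 =
  (p' * q - p * q') / q ^+ 2 * (r / s) + p / q * ((r' * s - r * s') / s ^+ 2).
Proof. by move=> q0 s0; field; rewrite q0 s0. Qed.

Lemma rderivD (f g : ratfun) : rderiv (f + g) = rderiv f + rderiv g.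
Proof.
have [p [q [q0 ->]]] := ratfunP f; have [r [s [s0 ->]]] := ratfunP g.
have tq : (tofrac q : ratfun) != 0 by rewrite tofrac_eq0.
have ts : (tofrac s : ratfun) != 0 by rewrite tofrac_eq0.
rewrite (addf_div _ _ tq ts).
have -> : (tofrac p : ratfun) * tofrac s + tofrac r * tofrac q =
          tofrac (p * s + r * q) by rewrite tofracD !tofracM.
rewrite -(tofracM q s).
rewrite (rderiv_frac _ (mulf_neq0 q0 s0)) (rderiv_frac _ q0) (rderiv_frac _ s0).
rewrite derivD !derivM !(tofracD, tofracN, tofracM).
exact: (@quot_addE ratfun).
Qed.

Lemma rderivM (f g : ratfun) : rderiv (f * g) = rderiv f * g + f * rderiv g.
Proof.
have [p [q [q0 ->]]] := ratfunP f; have [r [s [s0 ->]]] := ratfunP g.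
have tq : (tofrac q : ratfun) != 0 by rewrite tofrac_eq0.
have ts : (tofrac s : ratfun) != 0 by rewrite tofrac_eq0.
rewrite mulf_div -(tofracM q s) -(tofracM p r).
rewrite (rderiv_frac _ (mulf_neq0 q0 s0)) (rderiv_frac _ q0) (rderiv_frac _ s0).
rewrite !derivM !(tofracD, tofracN, tofracM).
exact: (@quot_mulE ratfun).
Qed.

End RatFun.

Section Z3.
Variables (F : fieldType) (x A0 A1 A2 A3 : F).

Definition Z3_2 : F := x * (2 * x - 1) * (x - 1) * (3 + 2 * A2).

Definition Z3_1 : F :=
  (5 * A2 ^+ 2 - A3 ^+ 2 + 12 * A2 + 7) * x ^+ 2
  + (A0 ^+ 2 - A1 ^+ 2 - 5 * A2 ^+ 2 + A3 ^+ 2 - 12 * A2 - 7) * x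
  - (A0 + 1 + A2) * (A0 - 1 - A2).

Definition Z3_0 : F :=
  (2 * A2 + 1) * (- A3 + A2 + 1) * (A3 + A2 + 1) * x
  + (2 * A2 + 1) *
    (A0 ^+ 2 - A1 ^+ 2 - A2 ^+ 2 + A3 ^+ 2 - 2 * A2 - 1) / 2.

Definition Z3 : diffop F :=
  (x ^+ 2 * (x - 1) ^+ 2) *: 'X^3 + Z3_2 *: 'X^2 + Z3_1 *: 'X + Z3_0%:P.

End Z3.

(* C(A_0, A_1, A_2, A_3), with C = R[i] and A_0, ..., A_3 indeterminates. *)
Definition parfield (R : realType) : fieldType := {fraction {mpoly R[i][4]}}.

(* The indeterminate A_k, for k < 4. *)
Definition par (R : realType) (k : nat) : parfield R :=
  tofrac ('X_(inord k) : {mpoly R[i][4]}).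

(* Main.v *)
Require Import Defs.
From mathcomp Require Import all_boot all_order all_algebra.
From mathcomp Require Import fraction ring.
From mathcomp Require Import complex reals mpoly.

(** Write E ~ E' when the left modules D/DE and D/DE' are isomorphic, by right
    multiplication by an operator P with E'P in DE. The remainder of such a P
    modulo E is a shift operator from E to E': it cannot vanish, as P has an
    inverse modulo E. Since ~ is an equivalence relation, it is enough to have
    Z_3(A) ~ Z_3(A - e_i - e_2) for i = 0, 1, 3: Z_3 is even in A_0, A_1 and
    A_3, which gives the steps e_i - e_2 as well, and together these vectors
    generate the even lattice. For each of the three steps the operator P, an
    operator P' with P'P congruent modulo E to a product of linear forms in the
    parameters (up to a factor in Q(x)) and the cofactors are explicit; they were
    guessed from the local exponents. *)

Set Implicit Arguments.
Unset Strict Implicit.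
Unset Printing Implicit Defensive.

Import GRing.Theory Num.Theory.
Local Open Scope ring_scope.

(** * Operators and their left modules *)

Section OperatorRing.
Variables (F : fieldType) (der : F -> F).
Hypothesis derD : forall f g, der (f + g) = der f + der g.
Hypothesis derM : forall f g, der (f * g) = der f * g + f * der g.

Local Notation "P ** Q" := (dcomp der P Q) (at level 40, left associativity).
Implicit Types (P Q R E T : diffop F) (c : F).

(** * Derivations and the composition of operators *)

Lemma der_const0 : der 0 = 0.
Proof. by apply: (@addrI _ (der 0)); rewrite -derD !addr0. Qed.

Lemma der_const1 : der 1 = 0.
Proof.
by apply: (@addrI _ (der 1)); rewrite -{3}[1]mulr1 derM mulr1 mul1r addr0.
Qed.

Lemma coef_map_der Q i : (map_poly der Q)`_i = der Q`_i.
Proof. exact: coef_map_id0 der_const0. Qed.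

Lemma dleftD P Q : dleft der (P + Q) = dleft der P + dleft der Q.
Proof.
apply/polyP=> i; rewrite /dleft mulrDl !coefD !coef_map_der coefD derD.
by rewrite -!addrA; congr (_ + _); rewrite addrCA.
Qed.

Lemma dleft0 : dleft der 0 = 0.
Proof. by apply: (@addrI _ (dleft der 0)); rewrite -dleftD !addr0. Qed.

Lemma dleftZ c Q : dleft der (c *: Q) = c *: dleft der Q + der c *: Q.
Proof.
apply/polyP=> i; rewrite /dleft -scalerAl scalerDr !(coefD, coefZ).
by rewrite !coef_map_der coefZ derM -addrA; congr (_ + _); rewrite addrC.
Qed.

Lemma dleftC c : dleft der c%:P = c *: 'X + (der c)%:P.
Proof.
rewrite /dleft mul_polyC; congr (_ + _); apply/polyP=> i.
by rewrite coef_map_der !coefC; case: eqP; rewrite ?der_const0.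
Qed.

Lemma dleftMX Q : dleft der (Q * 'X) = dleft der Q * 'X.
Proof.
rewrite /dleft mulrDl; congr (_ + _); apply/polyP=> i.
by rewrite coefMX !coef_map_der coefMX; case: eqP; rewrite ?der_const0.
Qed.

Lemma iter_dleftD n P Q :
  iter n (dleft der) (P + Q) = iter n (dleft der) P + iter n (dleft der) Q.
Proof. by elim: n => //= n ->; rewrite dleftD. Qed.

Lemma dcomp_widen n P Q : (size P <= n)%N ->
  P ** Q = \sum_(i < n) P`_i *: iter i (dleft der) Q.
Proof.
move=> le; rewrite /dcomp (big_ord_widen _ (fun i => P`_i *: iter i _ Q) le).
rewrite big_mkcond /=; apply: eq_bigr => i _; case: ltnP => // h.
by rewrite nth_default // scale0r.
Qed.

Lemma dcompDl P Q R : (P + Q) ** R = P ** R + Q ** R.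
Proof.
rewrite (dcomp_widen _ (size_polyD P Q)).
rewrite (dcomp_widen _ (leq_maxl (size P) (size Q))).
rewrite (dcomp_widen _ (leq_maxr (size P) (size Q))) -big_split /=.
by apply: eq_bigr => i _; rewrite coefD scalerDl.
Qed.

Lemma dcompDr P Q R : P ** (Q + R) = P ** Q + P ** R.
Proof.
rewrite /dcomp -big_split /=; apply: eq_bigr => i _.
by rewrite iter_dleftD scalerDr.
Qed.

Lemma dcompZl c P Q : (c *: P) ** Q = c *: (P ** Q).
Proof.
rewrite (dcomp_widen _ (size_scale_leq c P)) scaler_sumr.
by apply: eq_bigr => i _; rewrite coefZ scalerA.
Qed.

Lemma dcompC c Q : c%:P ** Q = c *: Q.
Proof.
by rewrite (dcomp_widen _ (size_polyC_leq1 c)) big_ord1 coefC.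
Qed.

Lemma dcomp0l Q : 0 ** Q = 0.
Proof. by rewrite -[0]/(0%:P) dcompC scale0r. Qed.

Lemma dcomp1l Q : 1 ** Q = Q.
Proof. by rewrite -[1]/(1%:P) dcompC scale1r. Qed.

Lemma dcompNl P Q : (- P) ** Q = - (P ** Q).
Proof. by rewrite -scaleN1r dcompZl scaleN1r. Qed.

Lemma dcompBl P Q R : (P - Q) ** R = P ** R - Q ** R.
Proof. by rewrite dcompDl dcompNl. Qed.

Lemma dcompBr P Q R : P ** (Q - R) = P ** Q - P ** R.
Proof. by apply/(canRL (addrK _)); rewrite -dcompDr subrK. Qed.

Lemma dcompMX P Q : (P * 'X) ** Q = P ** dleft der Q.
Proof.
rewrite (@dcomp_widen (size P).+1); last first.
  by rewrite (leq_trans (size_polyMleq _ _)) // size_polyX addn2.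
rewrite big_ord_recl coefMX scale0r add0r; apply: eq_bigr => i _.
by rewrite coefMX /= -iterSr.
Qed.

Lemma dcompXn n Q : 'X^n ** Q = iter n (dleft der) Q.
Proof.
elim: n Q => [|n IH] Q; first by rewrite expr0 dcomp1l.
by rewrite exprSr dcompMX IH iterSr.
Qed.

Lemma dcompr1 P : P ** 1 = P.
Proof.
rewrite /dcomp -[RHS]coefK poly_def; apply: eq_bigr => i _; congr (_ *: _).
elim: (nat_of_ord i) => [|n /= ->]; first by rewrite expr0.
elim: n => [|n IH]; last by rewrite exprSr dleftMX IH -exprSr.
by rewrite expr0 dleftC der_const1 polyC0 addr0 scale1r.
Qed.

(** Associativity for the left factor d; the general case follows by induction on the leftmost
    factor. *)
Lemma dleft_dcomp P Q : dleft der (P ** Q) = dleft der P ** Q.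
Proof.
elim/poly_ind: P Q => [|P c IH] Q; first by rewrite dleft0 dcomp0l dleft0.
rewrite dcompDl dcompMX dcompC !dleftD dleftZ dleftMX dleftC IH.
rewrite dcompDl dcompMX (dcompDl (c *: 'X)) dcompC dcompZl.
by rewrite -['X]mul1r dcompMX dcomp1l.
Qed.

Lemma dcompA P Q R : P ** (Q ** R) = (P ** Q) ** R.
Proof.
elim/poly_ind: P Q => [|P c IH] Q; first by rewrite !dcomp0l.
by rewrite !dcompDl !dcompMX !dcompC dleft_dcomp IH dcompZl.
Qed.

(** * Orders and division on the right *)

Lemma size_map_der Q : (size (map_poly der Q) <= size Q)%N.
Proof. by rewrite /map_poly; exact: size_poly. Qed.

Lemma size_dleft Q : Q != 0 -> size (dleft der Q) = (size Q).+1.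
Proof.
move=> Q0; rewrite /dleft size_polyDl size_mulX //.
by rewrite ltnS size_map_der.
Qed.

Lemma size_iter_dleft n Q :
  Q != 0 -> size (iter n (dleft der) Q) = (n + size Q)%N.
Proof.
move=> Q0; elim: n => //= n IH; rewrite size_dleft ?IH //.
by rewrite -size_poly_eq0 IH addn_eq0 negb_and size_poly_eq0 Q0 orbT.
Qed.

(** In (P d + c) Q = P (d Q) + c Q with P non-zero, the first term has the larger order, so orders
    add. A size exceeds the order by one, hence the predecessor. *)
Lemma size_dcomp P Q :
  P != 0 -> Q != 0 -> size (P ** Q) = (size P + size Q).-1.
Proof.
elim/poly_ind: P Q => [|P c IH] Q; first by rewrite eqxx.
have [->|P0] := eqVneq P 0.
  rewrite mul0r add0r polyC_eq0 => c0 _.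
  by rewrite dcompC size_scale // size_polyC c0.
move=> _ Q0; have dQ0 : dleft der Q != 0.
  by rewrite -size_poly_eq0 size_dleft.
rewrite dcompDl dcompMX dcompC size_polyDl IH ?size_dleft //.
  rewrite size_polyDl size_mulX ?addnS //= ltnS.
  by rewrite (leq_trans (size_polyC_leq1 c)) // size_poly_gt0.
rewrite addnS /=; apply: leq_ltn_trans (size_scale_leq _ _) _.
by rewrite -[ltnLHS]add0n ltn_add2r size_poly_gt0.
Qed.

(** Euclidean division: while the order of P is at least that of E, a multiple of d^k E cancels the
    leading term of P. *)
Lemma dcomp_division P E : E != 0 ->
  exists T R, P = T ** E + R /\ (size R < size E)%N.
Proof.
move=> E0; have [n] := ubnP (size P); elim: n P => // n IH P ltn.
have [lt|le] := ltnP (size P) (size E).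
  by exists 0, P; rewrite dcomp0l add0r.
set k := (size P - size E)%N; set G := iter k (dleft der) E.
have sG : size G = size P by rewrite size_iter_dleft // subnK.
have P0 : (0 < size P)%N by rewrite (leq_trans _ le) // size_poly_gt0.
have lG0 : lead_coef G != 0 by rewrite lead_coef_eq0 -size_poly_gt0 sG.
set c := lead_coef P / lead_coef G.
have [|T [R [PE sR]]] := IH (P - c *: G).
  rewrite -ltnS (leq_trans _ ltn) // ltnS -(prednK P0) ltnS.
  apply/leq_sizeP=> j; rewrite leq_eqVlt => /predU1P[<-|lt].
    rewrite coefB coefZ -{2}sG -!lead_coefE /c divfK //.
    exact: subrr.
  rewrite prednK // in lt.
  by rewrite coefB coefZ !nth_default ?sG // mulr0 subr0.
exists (T + c *: 'X^k), R; split=> //.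
by rewrite dcompDl dcompZl dcompXn addrAC -PE subrK.
Qed.

(** * The left ideal DE and the quotient D/DE *)

Definition left_multiple E P := exists T, P = T ** E.

Lemma left_multiple0 E : left_multiple E 0.
Proof. by exists 0; rewrite dcomp0l. Qed.

Lemma left_multipleD E P Q :
  left_multiple E P -> left_multiple E Q -> left_multiple E (P + Q).
Proof. by move=> [T ->] [U ->]; exists (T + U); rewrite dcompDl. Qed.

Lemma left_multipleN E P : left_multiple E P -> left_multiple E (- P).
Proof. by move=> [T ->]; exists (- T); rewrite dcompNl. Qed.

Lemma left_multiple_comp E R P : left_multiple E P -> left_multiple E (R ** P).
Proof. by move=> [T ->]; exists (R ** T); rewrite dcompA. Qed.

(** Orders add, so a non-zero element of DE has at least the order of E; thus remainders modulo E
    are unique. *)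
Lemma left_multiple_small E P :
  left_multiple E P -> (size P < size E)%N -> P = 0.
Proof.
move=> [T ->]; have [->|T0] := eqVneq T 0; first by rewrite dcomp0l.
have [->|E0] := eqVneq E 0; first by rewrite size_poly0.
rewrite size_dcomp // ltnNge -(subnKC (_ : 0 < size T)%N) ?size_poly_gt0 //.
by rewrite add1n /= leq_addl.
Qed.

(** Remainders identify D/DE with the row vectors of length the order of E. Right multiplication by
    P commutes with scalars on the left, so followed by taking remainders it is given by a
    matrix. *)
Lemma remainder_matrix E P : E != 0 -> exists M : 'M[F]_((size E).-1),
  forall r, left_multiple E (rVpoly r ** P - rVpoly (r *m M)).
Proof.
move=> E0; pose n := (size E).-1.
have /fin_all_exists[m mP] (i : 'I_n) : exists m : 'rV[F]_n,
    left_multiple E ('X^i ** P - rVpoly m).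
  have [T [R [-> sR]]] := dcomp_division ('X^i ** P) E0.
  exists (poly_rV R); rewrite poly_rV_K; first by exists T; rewrite addrK.
  by rewrite -ltnS prednK // size_poly_gt0.
exists (\matrix_i m i) => r.
have rE : rVpoly r = \sum_i r 0 i *: 'X^i.
  apply/polyP=> j; rewrite coef_rVpoly coef_sum.
  case: insubP => [i _ <-|/= ltj].
    rewrite (bigD1 i) //= coefZ coefXn eqxx mulr1 big1 ?addr0 // => k ki.
    by rewrite coefZ coefXn eq_sym val_eqE (negPf ki) mulr0.
  rewrite big1 // => k _; rewrite coefZ coefXn; case: eqP => [jk|_].
    by rewrite jk ltn_ord in ltj.
  by rewrite mulr0.
rewrite rE mulmx_sum_row linear_sum.
rewrite (big_morph (fun T => T ** P) (fun T U => dcompDl T U P) (dcomp0l P)).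
rewrite -sumrB; apply: big_ind => [||i _]; first exact: left_multiple0.
  exact: left_multipleD.
rewrite dcompZl linearZ /= -scalerBr -dcompC rowK.
exact: left_multiple_comp.
Qed.

(* Right multiplication by [P], from D/DE' to D/DE, is linear over [F]; right
   multiplication by [P'] is a one-sided inverse, hence a two-sided one because
   both quotients have the same finite dimension. *)
Lemma left_multiple_cancel E E' P P' R :
  E != 0 -> E' != 0 -> size E' = size E ->
  left_multiple E (E' ** P) -> left_multiple E (P' ** P - 1) ->
  left_multiple E (R ** P) -> left_multiple E' R.
Proof.
move=> E0 E'0 sE EP PP RP.
have [M MP] := remainder_matrix P E0.
have [N NP] := remainder_matrix P' E'0.
move: N NP; rewrite sE => N NP.
(* The congruence P'P = 1 modulo E in matrix form. The error of [N] is a multiple of E', which right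
   multiplication by P sends into DE. *)
have NM : N *m M = 1%:M.
  apply/row_matrixP => i; rewrite rowE [in RHS]rowE mulmx1 mulmxA.
  set r := delta_mx _ _.
  apply: (can_inj (@rVpolyK F _)); apply/eqP; rewrite -subr_eq0; apply/eqP.
  apply: (@left_multiple_small E); last first.
    rewrite -linearB /= (leq_ltn_trans (size_poly _ _)) //.
    by rewrite prednK // size_poly_gt0.
  have -> : rVpoly (r *m N *m M) - rVpoly r =
      rVpoly r ** (P' ** P - 1) -
      ((rVpoly r ** P' - rVpoly (r *m N)) ** P +
       (rVpoly (r *m N) ** P - rVpoly (r *m N *m M))).
    rewrite dcompBr dcompr1 dcompBl dcompA [X in _ = _ - X]addrA subrK opprB.
    by rewrite [RHS]addrC addrA subrK.
  apply: left_multipleD; first exact: left_multiple_comp.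
  apply/left_multipleN/left_multipleD => //.
  have [T ->] := NP r.
  by rewrite -dcompA; exact: left_multiple_comp.
(* As E'P lies in DE, R may be replaced by its remainder modulo E', a vector in the kernel of [M];
   [M] is square, hence invertible on both sides. *)
have [T [S [RE sS]]] := dcomp_division R E'0.
have SP : left_multiple E (S ** P).
  have -> : S ** P = R ** P - T ** (E' ** P).
    by rewrite RE dcompDl dcompA addrAC subrr add0r.
  by apply: left_multipleD => //; apply/left_multipleN/left_multiple_comp.
have sS' : (size S <= (size E).-1)%N.
  by rewrite -ltnS prednK ?size_poly_gt0 // -sE.
set s : 'rV_(size E).-1 := poly_rV S.
have Ss : rVpoly s = S by rewrite poly_rV_K.
have sM0 : s *m M = 0.
  apply: (can_inj (@rVpolyK F _)); rewrite linear0.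
  apply: (@left_multiple_small E); last first.
    rewrite (leq_ltn_trans (size_poly _ _)) //.
    by rewrite prednK // size_poly_gt0.
  have -> : rVpoly (s *m M) = S ** P - (rVpoly s ** P - rVpoly (s *m M)).
    by rewrite Ss opprB addrC subrK.
  by apply: left_multipleD => //; exact: left_multipleN.
have S0 : S = 0.
  by rewrite -Ss -[s]mulmx1 -(mulmx1C NM) mulmxA sM0 mul0mx linear0.
by rewrite RE S0 addr0; exists T.
Qed.

(* Isomorphism of the left modules D/DE and D/DE'. *)
Definition diffop_iso E E' := [/\ E != 0, size E' = size E &
  exists P P', left_multiple E (E' ** P) /\ left_multiple E (P' ** P - 1)].

Lemma diffop_iso_refl E : E != 0 -> diffop_iso E E.
Proof.
move=> E0; split=> //; exists 1, 1; rewrite dcompr1 dcomp1l subrr.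
by split; [exists 1; rewrite dcomp1l | exact: left_multiple0].
Qed.

(** The inverse is P'. Both E P' and P P' - 1 lie in DE' because their products with P on the right
    lie in DE. *)
Lemma diffop_iso_sym E E' : diffop_iso E E' -> diffop_iso E' E.
Proof.
move=> [E0 sE [P [P' [EP PP]]]].
have E'0 : E' != 0 by rewrite -size_poly_eq0 sE size_poly_eq0.
split=> //; exists P', P.
have PPc R : R ** P' ** P = R ** (P' ** P - 1) + R.
  by rewrite dcompBr dcompr1 dcompA subrK.
split; apply: (left_multiple_cancel E0 E'0 sE EP PP).
  rewrite PPc; apply: left_multipleD; first exact: left_multiple_comp.
  by exists 1; rewrite dcomp1l.
by rewrite dcompBl dcomp1l PPc addrK; exact: left_multiple_comp.
Qed.

Lemma diffop_iso_trans E1 E2 E3 :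
  diffop_iso E1 E2 -> diffop_iso E2 E3 -> diffop_iso E1 E3.
Proof.
move=> [E10 sE2 [P [P' [[Q EP] PP]]]] [_ sE3 [R [R' [[S ER] [T RR]]]]].
split=> //; first by rewrite sE3.
exists (R ** P), (P' ** R'); split.
  by rewrite dcompA ER -dcompA EP dcompA; exists (S ** Q).
(* The first term is in DE1: R'R - 1 is a left multiple of E2, and E2 P is one of E1. *)
have -> : P' ** R' ** (R ** P) - 1 =
    P' ** (R' ** R - 1) ** P + (P' ** P - 1).
  by rewrite dcompBr dcompr1 dcompBl !dcompA addrA subrK.
apply: left_multipleD => //; rewrite RR -!dcompA EP !dcompA.
by exists (P' ** T ** Q).
Qed.

(** Dividing P' by u on the left keeps the congruence, so u need not be a constant; below it may
    contain a factor x or x - 1. *)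
Lemma diffop_iso_intro E E' P P' Q S u :
    E != 0 -> size E' = size E -> u != 0 ->
    E' ** P = Q ** E -> P' ** P = u%:P + S ** E ->
  diffop_iso E E'.
Proof.
move=> E0 sE u0 EP PP; split=> //; exists P, (u^-1 *: P'); split.
  by exists Q.
rewrite dcompZl PP scalerDr scale_polyC mulVf // -dcompZl addrC addKr.
by exists (u^-1 *: S).
Qed.

Lemma diffop_iso_chain (E : int -> diffop F) :
    (forall k, E k != 0) -> (forall k, diffop_iso (E k) (E (k + 1))) ->
  forall k, diffop_iso (E 0) (E k).
Proof.
move=> E0 step; elim/int_rect=> [|n IH|n IH].
- exact: diffop_iso_refl.
- by apply: diffop_iso_trans IH _; rewrite intS addrC.
- apply: diffop_iso_trans IH (diffop_iso_sym _).
  by have := step (- n.+1%:Z); rewrite intS opprD addrAC addNr add0r.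
Qed.

Lemma diffop_iso_shift_operator E E' :
  size E = 4%N -> diffop_iso E E' -> exists P, shift_operator der E E' P.
Proof.
move=> s4 [E0 _ [P [P' [EP PP]]]].
have [T [R [PE sR]]] := dcomp_division P E0; exists R.
have RE : R = P - T ** E by rewrite PE addrAC subrr add0r.
split; last first.
- rewrite -/(left_multiple _ _) RE dcompBr.
  apply: left_multipleD => //; apply/left_multipleN/left_multiple_comp.
  by exists T.
- by move: sR; rewrite s4 /dorder; case: (size R) => //= n; rewrite ltnS.
apply/eqP=> R0; have : left_multiple E 1.
  have -> : 1 = P' ** P - (P' ** P - 1) by rewrite subKr.
  apply: left_multipleD; last exact: left_multipleN.
  by rewrite PE R0 addr0 dcompA; exists (P' ** T).
move/left_multiple_small; rewrite size_poly1 s4 => /(_ isT)/eqP.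
by rewrite oner_eq0.
Qed.

End OperatorRing.

(* An operator with coefficients polynomial in x is given by the list of lists
   of coefficients, so that composition is computed by simplification. *)
Section PolynomialCoefficients.
Variables (F : fieldType) (der : F -> F).
Hypothesis derD : forall f g, der (f + g) = der f + der g.
Hypothesis derM : forall f g, der (f * g) = der f * g + f * der g.
Variable x : F.
Hypothesis derx : der x = 1.

Implicit Types (s t : seq F) (ss : seq (seq F)).

Lemma derN f : der (- f) = - der f.
Proof. by apply: (@addrI _ (der f)); rewrite -derD !subrr der_const0. Qed.

Lemma der_nat n : der n%:R = 0.
Proof.
elim: n => [|n IH]; first exact: der_const0.
by rewrite mulrS derD IH der_const1 // addr0.
Qed.

Lemma derV c : der c = 0 -> der c^-1 = 0.
Proof.
move=> dc; have [->|c0] := eqVneq c 0; first by rewrite invr0 der_const0.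
have := der_const1 derM; rewrite -{1}(mulfV c0) derM dc mul0r add0r.
by move/eqP; rewrite mulf_eq0 (negPf c0) => /eqP.
Qed.

Definition constants s := foldr (fun c P => der c = 0 /\ P) True s.

Definition pol s := foldr (fun c y => c + x * y) 0 s.

Fixpoint add_seq s t :=
  match s, t with
  | a :: s', b :: t' => (a + b) :: add_seq s' t'
  | [::], _ => t
  | _, [::] => s
  end.

(** Follows the Horner form: (a + x q)' = q + x q' for constant a. *)
Fixpoint deriv_seq s :=
  if s is _ :: s' then add_seq s' (0 :: deriv_seq s') else [::].

Lemma pol_add s t : pol (add_seq s t) = pol s + pol t.
Proof.
elim: s t => [|a s IH] [|b t]; rewrite /= ?add0r ?addr0 // IH.
by rewrite mulrDr addrACA.
Qed.

Lemma constants_add s t :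
  constants s -> constants t -> constants (add_seq s t).
Proof.
elim: s t => [|a s IH] [|b t] //= [da ds] [db dt]; split; last exact: IH.
by rewrite derD da db addr0.
Qed.

Lemma constants_deriv s : constants s -> constants (deriv_seq s).
Proof.
elim: s => //= a s IH [_ ds]; apply: constants_add => //=; split.
  exact: der_const0.
exact: IH.
Qed.

Lemma der_pol s : constants s -> der (pol s) = pol (deriv_seq s).
Proof.
elim: s => [_|a s IH [da ds]]; first exact: der_const0.
by rewrite [deriv_seq _]/= pol_add /= derD derM da derx IH // mul1r !add0r.
Qed.

(** [t] carries the coefficient of the preceding order, which composition with d moves up by one. *)
Fixpoint dleft_seq t ss :=
  if ss is s :: ss' then add_seq t (deriv_seq s) :: dleft_seq s ss'
  else [:: t].

(** Uses (a + P d) Q = a Q + P (d Q). Only the right factor is differentiated, so only it needs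
    coefficients given as polynomials in x; the left factor and the result have coefficients in
    F. *)
Fixpoint dcomp_seq s ss :=
  if s is a :: s' then
    add_seq [seq a * pol t | t <- ss] (dcomp_seq s' (dleft_seq [::] ss))
  else [::].

Definition constant_coefs ss := foldr (fun s P => constants s /\ P) True ss.

Lemma constant_coefs_dleft t ss :
  constants t -> constant_coefs ss -> constant_coefs (dleft_seq t ss).
Proof.
elim: ss t => [|s ss IH] t dt //= [ds dss]; split; last exact: IH.
by apply: constants_add => //; apply: constants_deriv.
Qed.

Definition polop ss : diffop F := Poly [seq pol s | s <- ss].

Lemma Poly_cons (a : F) s : Poly (a :: s) = Poly s * 'X + a%:P.
Proof. by rewrite /= cons_poly_def. Qed.

Lemma Poly_add s t : Poly s + Poly t = Poly (add_seq s t).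
Proof.
elim: s t => [|a s IH] [|b t]; rewrite /= ?add0r ?addr0 //.
by rewrite !cons_poly_def -IH polyCD mulrDl addrACA.
Qed.

Lemma Poly_scale c s : c *: Poly s = Poly [seq c * a | a <- s].
Proof.
elim: s => [|a s IH]; first by rewrite scaler0.
by rewrite /= !cons_poly_def scalerDr scalerAl IH scale_polyC.
Qed.

Lemma dleft_polop ss :
  constant_coefs ss -> dleft der (polop ss) = polop (dleft_seq [::] ss).
Proof.
move=> dss; suff E t : polop (dleft_seq t ss) =
    (pol t)%:P + dleft der (polop ss) by rewrite E add0r.
elim: ss dss t => [_|s ss IH [ds dss]] t.
  by rewrite /polop Poly_cons mul0r add0r dleft0 // addr0.
rewrite /polop [dleft_seq _ _]/= !map_cons !Poly_cons -!/(polop _) IH //.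
rewrite dleftD // dleftMX // dleftC // pol_add der_pol //.
by rewrite polyCD -mul_polyC; ring.
Qed.

Lemma dcomp_polop s ss : constant_coefs ss ->
  dcomp der (Poly s) (polop ss) = Poly (dcomp_seq s ss).
Proof.
elim: s ss => [|a s IH] ss dss; first by rewrite dcomp0l.
rewrite Poly_cons dcompDl dcompMX dcompC dleft_polop //.
rewrite IH; last exact: constant_coefs_dleft.
by rewrite Poly_scale addrC Poly_add -map_comp.
Qed.

End PolynomialCoefficients.

(** * The steps -e_i - e_2 *)

(* For the step lowering [A2] and [c] by 1, the inverse found below composed
   with the step is congruent modulo Z3 to this constant times 1/2, up to sign
   and, unless [c] is A_3, up to x or x - 1. *)
Definition step_factor (F : fieldType) (A2 c a b : F) : F :=
  let w := c + A2 - 1 in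
  (2 * A2 - 1) * ((w + a + b) * (w + a - b) * (w - a + b) * (w - a - b)).

Section Steps.
Variables (F : fieldType) (der : F -> F).
Hypothesis derD : forall f g, der (f + g) = der f + der g.
Hypothesis derM : forall f g, der (f * g) = der f * g + f * der g.
Variable x : F.
Hypothesis derx : der x = 1.
Hypothesis two_neq0 : 2 != 0 :> F.

Definition Z3_coefs (A0 A1 A2 A3 : F) : seq (seq F) :=
  [:: [:: (2 * A2 + 1) *
            (A0 ^+ 2 - A1 ^+ 2 - A2 ^+ 2 + A3 ^+ 2 - 2 * A2 - 1) / 2;
          (2 * A2 + 1) * (- A3 + A2 + 1) * (A3 + A2 + 1)];
      [:: - (A0 + 1 + A2) * (A0 - 1 - A2);
          A0 ^+ 2 - A1 ^+ 2 - 5 * A2 ^+ 2 + A3 ^+ 2 - 12 * A2 - 7;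
          5 * A2 ^+ 2 - A3 ^+ 2 + 12 * A2 + 7];
      [:: 0; 3 + 2 * A2; - 3 * (3 + 2 * A2); 2 * (3 + 2 * A2)];
      [:: 0; 0; 1; -2; 1]].

Lemma Z3_polop A0 A1 A2 A3 :
  Z3 x A0 A1 A2 A3 = polop x (Z3_coefs A0 A1 A2 A3).
Proof.
rewrite /Z3_coefs.
rewrite [RHS](_ : _ = Poly [:: Z3_0 x A0 A1 A2 A3; Z3_1 x A0 A1 A2 A3;
                           Z3_2 x A2; x ^+ 2 * (x - 1) ^+ 2]).
  rewrite /Z3 !Poly_cons mul0r add0r !mulrDl -!mul_polyC -!mulrA.
  by rewrite -expr2 -exprS.
rewrite /polop /Z3_0 /Z3_1 /Z3_2 /=; do !congr cons_poly; ring.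
Qed.

Lemma size_Z3 A0 A1 A2 A3 : x != 0 -> x - 1 != 0 ->
  size (Z3 x A0 A1 A2 A3) = 4%N.
Proof.
move=> x0 x1; have l0 : x ^+ 2 * (x - 1) ^+ 2 != 0.
  by rewrite mulf_neq0 ?expf_neq0.
rewrite /Z3 -!addrA size_polyDl size_scale ?size_polyXn //.
rewrite ltnS; apply/leq_sizeP=> j hj.
rewrite !(coefD, coefZ, coefXn, coefX, coefC).
by case: j hj => [|[|[|j]]] //= _; rewrite !mulr0 !addr0.
Qed.

Lemma Z3_opp0 A0 A1 A2 A3 : Z3 x (- A0) A1 A2 A3 = Z3 x A0 A1 A2 A3.
Proof. by rewrite /Z3 /Z3_1 /Z3_0; congr (_ + _ *: 'X + _%:P); ring. Qed.

Lemma Z3_opp1 A0 A1 A2 A3 : Z3 x A0 (- A1) A2 A3 = Z3 x A0 A1 A2 A3.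
Proof. by rewrite /Z3 /Z3_1 /Z3_0; congr (_ + _ *: 'X + _%:P); ring. Qed.

Lemma Z3_opp3 A0 A1 A2 A3 : Z3 x A0 A1 A2 (- A3) = Z3 x A0 A1 A2 A3.
Proof. by rewrite /Z3 /Z3_1 /Z3_0; congr (_ + _ *: 'X + _%:P); ring. Qed.

(* The coefficients of order 0, 1 and 2 are the quadratic polynomial with values
   [g0], [g1] at 0, 1 and leading coefficient [g2], then x(x-1)(b0 + b1 x) and
   x^2(x-1)^2. *)
Definition lower_coefs (b0 b1 g0 g1 g2 : F) :=
  [:: [:: g0; g1 - g0 - g2; g2]; [:: 0; - b0; b0 - b1; b1];
      [:: 0; 0; 1; -2; 1]].

Hypotheses (x_neq0 : x != 0) (x1_neq0 : x - 1 != 0).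
Variables (A0 A1 A2 A3 : F).
Hypotheses (d0 : der A0 = 0) (d1 : der A1 = 0).
Hypotheses (d2 : der A2 = 0) (d3 : der A3 = 0).

Ltac solve_constants :=
  rewrite /= ?expr2 !(derD, derM, derN derD, d0, d1, d2, d3, der_nat derD derM,
    der_const0 derD, der_const1 derM, derV derD derM (der_nat derD derM 2),
    mul0r, mulr0, add0r, addr0, oppr0); do !split.

(** Reduces a step to two identities between lists over F, decidable coefficient by coefficient.
    Here [h] lists the coefficients of the inverse P' up to the factor [u], and [s] those of the
    cofactor of Z3 in P'P. *)
Lemma Z3_iso_intro B0 B1 B2 B3 b0 b1 g0 g1 g2 g0' g1' g2' h s u :
    constant_coefs der (lower_coefs b0 b1 g0 g1 g2) -> u != 0 ->
    let E := Z3_coefs A0 A1 A2 A3 in let E' := Z3_coefs B0 B1 B2 B3 in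
    let P := lower_coefs b0 b1 g0 g1 g2 in
    let Q := lower_coefs b0 b1 g0' g1' g2' in
    dcomp_seq x [seq pol x t | t <- E'] P =
      dcomp_seq x [seq pol x t | t <- Q] E ->
    dcomp_seq x h P = add_seq [:: u] (dcomp_seq x s E) ->
  diffop_iso der (Z3 x A0 A1 A2 A3) (Z3 x B0 B1 B2 B3).
Proof.
move=> dP u0 E E' P Q EP hP.
have dE : constant_coefs der E by solve_constants.
have E0 : Z3 x A0 A1 A2 A3 != 0 by rewrite -size_poly_eq0 size_Z3.
apply: (@diffop_iso_intro _ _ _ _ (polop x P) (Poly h) (polop x Q)
  (Poly s) u) => //; rewrite ?size_Z3 // !Z3_polop.
  by rewrite !dcomp_polop // EP.
have -> : u%:P = Poly [:: u] by rewrite Poly_cons mul0r add0r.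
by rewrite !dcomp_polop // hP Poly_add.
Qed.

Lemma Z3_lower0 : step_factor A2 A0 A1 A3 != 0 ->
  diffop_iso der (Z3 x A0 A1 A2 A3) (Z3 x (A0 - 1) A1 (A2 - 1) A3).
Proof.
rewrite /step_factor; set w := A0 + A2 - 1 => c0.
have mhalf : - 2^-1 != 0 :> F by rewrite oppr_eq0 invr_eq0.
pose n := w * (A2 - A0 + 1) + A1 ^+ 2 - A3 ^+ 2.
(* P keeps an exponent at 0 or 1 and lowers one at infinity by 2, unless it is a root of the
   indicial polynomial of P. The roots are -A0-A2 and A0+A2-1 at 0, -A2+A1 and -A2-A1 at 1, A2+1+A3
   and A2+1-A3 at infinity; they include every exponent of Z3 that the step changes in another
   way. *)
apply: (@Z3_iso_intro _ _ _ _ (-2) (2 * A2 + 3)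
  (- (A2 + A0) * (A2 + A0 - 1)) (A2 ^+ 2 - A1 ^+ 2) ((A2 + 1) ^+ 2 - A3 ^+ 2)
  (- (A2 + A0 - 1) * (A2 + A0 - 2)) (A2 ^+ 2 - A1 ^+ 2)
  ((A2 + 1) ^+ 2 - A3 ^+ 2)
  [:: (2 * A2 - 1) * n; 2 * w * (A0 - A2 - 1) + (n + 4 * w * A2) * x;
      2 * w * x * (x - 1)]
  [:: 2 * w * (w - 1) + (A1 ^+ 2 - A3 ^+ 2 + w * (A2 - A0 + 3)) * x;
      2 * w * x * (x - 1)] _ _ (mulf_neq0 x_neq0 (mulf_neq0 mhalf c0))).
- by solve_constants.
- by rewrite /=; congr [:: _; _; _; _; _; _]; field.
- by rewrite /= /n /w; congr [:: _; _; _; _; _]; field.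
Qed.

(** Mirror image of [Z3_lower0]: x -> 1 - x sends d to -d and turns Z3 into -Z3 with A0 and A1
    exchanged, and all the data below are transported accordingly. *)
Lemma Z3_lower1 : step_factor A2 A1 A0 A3 != 0 ->
  diffop_iso der (Z3 x A0 A1 A2 A3) (Z3 x A0 (A1 - 1) (A2 - 1) A3).
Proof.
rewrite /step_factor; set w := A1 + A2 - 1 => c0.
pose n := w * (A2 - A1 + 1) + A0 ^+ 2 - A3 ^+ 2.
apply: (@Z3_iso_intro _ _ _ _ (- (2 * A2 + 1)) (2 * A2 + 3)
  (A2 ^+ 2 - A0 ^+ 2) (- (A2 + A1) * (A2 + A1 - 1)) ((A2 + 1) ^+ 2 - A3 ^+ 2)
  (A2 ^+ 2 - A0 ^+ 2) (- (A2 + A1 - 1) * (A2 + A1 - 2))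
  ((A2 + 1) ^+ 2 - A3 ^+ 2)
  [:: (2 * A2 - 1) * n;
      - 2 * w * (A1 - A2 - 1) + (n + 4 * w * A2) * (x - 1);
      2 * w * x * (x - 1)]
  [:: - 2 * w * (w - 1) + (A0 ^+ 2 - A3 ^+ 2 + w * (A2 - A1 + 3)) * (x - 1);
      2 * w * x * (x - 1)]
  _ _ (mulf_neq0 x1_neq0 (mulf_neq0 (invr_neq0 two_neq0) c0))).
- by solve_constants.
- by rewrite /=; congr [:: _; _; _; _; _; _]; field.
- by rewrite /= /n /w; congr [:: _; _; _; _; _]; field.
Qed.

Lemma Z3_lower3 : step_factor A2 A3 A0 A1 != 0 ->
  diffop_iso der (Z3 x A0 A1 A2 A3) (Z3 x A0 A1 (A2 - 1) (A3 - 1)).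
Proof.
rewrite /step_factor; set w := A3 + A2 - 1 => c0.
pose v := A3 + 3 * A2 - 1.
(* The indicial roots of P are now -A2+A0 and -A2-A0 at 0, -A2+A1 and -A2-A1 at 1, A2+1-A3 and
   A3+3A2 at infinity; A2+1-A3 is the exponent there that the step leaves fixed. *)
apply: (@Z3_iso_intro _ _ _ _ (- (2 * A2 + 1)) (2 * (2 * A2 + 1))
  (A2 ^+ 2 - A0 ^+ 2) (A2 ^+ 2 - A1 ^+ 2) ((A3 + 3 * A2) * (A2 + 1 - A3))
  (A2 ^+ 2 - A0 ^+ 2) (A2 ^+ 2 - A1 ^+ 2) (v * (A2 - A3 + 2))
  [:: 2 * (2 * A2 - 1) * w ^+ 2;
      w * v * (2 * x - 1) + A1 ^+ 2 - A0 ^+ 2; 2 * w * x * (x - 1)]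
  [:: w * v * (2 * x - 1) + A1 ^+ 2 - A0 ^+ 2; 2 * w * x * (x - 1)]
  _ _ (mulf_neq0 (invr_neq0 two_neq0) c0)).
- by solve_constants.
- by rewrite /=; congr [:: _; _; _; _; _; _]; rewrite /v; field.
- by rewrite /= /v /w; congr [:: _; _; _; _; _]; field.
Qed.

End Steps.

(** * The even lattice *)

(* Requiring only [k2 != 0] is enough: [A2] occurs in every linear form of
   [step_factor]. *)
Definition nonresonant (F : fieldType) (A0 A1 A2 A3 : F) :=
  forall k0 k1 k2 k3 m : int, k2 != 0 ->
    k0%:~R * A0 + k1%:~R * A1 + k2%:~R * A2 + k3%:~R * A3 + m%:~R != 0.

Lemma nonresonant_shift (F : fieldType) (A0 A1 A2 A3 : F) (n0 n1 n2 n3 : int) :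
  nonresonant A0 A1 A2 A3 ->
  nonresonant (A0 + n0%:~R) (A1 + n1%:~R) (A2 + n2%:~R) (A3 + n3%:~R).
Proof.
move=> nr k0 k1 k2 k3 m /(nr k0 k1 _ k3
  (m + k0 * n0 + k1 * n1 + k2 * n2 + k3 * n3)); congr (_ != _); ring.
Qed.

Section NonresonantParameters.
Variables (F : fieldType) (A0 A1 A2 A3 : F).
Hypothesis nr : nonresonant A0 A1 A2 A3.

Lemma step_factor_neq0 : step_factor A2 A0 A1 A3 != 0.
Proof.
rewrite /step_factor !mulf_neq0 //.
- have := nr 0 0 0 (-1) (isT : 2 != 0 :> int); congr (_ != _); ring.
- have := nr 1 1 1 (-1) (isT : 1 != 0 :> int); congr (_ != _); ring.
- have := nr 1 1 (-1) (-1) (isT : 1 != 0 :> int); congr (_ != _); ring.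
- have := nr 1 (-1) 1 (-1) (isT : 1 != 0 :> int); congr (_ != _); ring.
- have := nr 1 (-1) (-1) (-1) (isT : 1 != 0 :> int); congr (_ != _); ring.
Qed.

Lemma nonresonant_opp0 : nonresonant (- A0) A1 A2 A3.
Proof.
by move=> k0 k1 k2 k3 m /(nr (- k0) k1 k3 m); congr (_ != _); ring.
Qed.

Lemma nonresonant_swap01 : nonresonant A1 A0 A2 A3.
Proof.
by move=> k0 k1 k2 k3 m /(nr k1 k0 k3 m); congr (_ != _); ring.
Qed.

Lemma nonresonant_swap03 : nonresonant A3 A1 A2 A0.
Proof.
by move=> k0 k1 k2 k3 m /(nr k3 k1 k0 m); congr (_ != _); ring.
Qed.

End NonresonantParameters.

(** * Constants and the variable x in the field of rational functions *)

Lemma rderiv_ratC (K : fieldType) (c : K) : rderiv (ratC c) = 0.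
Proof.
rewrite /ratC -[tofrac _]divr1 -[X in _ / X]tofrac1 rderiv_frac ?oner_neq0 //.
by rewrite derivC -[1]/(1%:P) derivC mul0r mulr0 subrr tofrac0 mul0r.
Qed.

Lemma rderiv_ratX (K : fieldType) : rderiv (ratX K) = 1.
Proof.
rewrite /ratX -[tofrac _]divr1 -[X in _ / X]tofrac1 rderiv_frac ?oner_neq0 //.
rewrite derivX -[X in 'X * X^`()]/(1%:P) derivC mulr0 subr0 mulr1.
by rewrite tofrac1 expr1n divr1.
Qed.

Lemma ratX_subC_neq0 (K : fieldType) (c : K) : ratX K - ratC c != 0.
Proof. by rewrite -tofracB tofrac_eq0 polyXsubC_eq0. Qed.

Lemma nonresonant_ratC (K : fieldType) (a0 a1 a2 a3 : K) :
  nonresonant a0 a1 a2 a3 ->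
  nonresonant (ratC a0) (ratC a1) (ratC a2) (ratC a3).
Proof.
move=> nr k0 k1 k2 k3 m /(nr k0 k1 _ k3 m) h.
pose f : {rmorphism K -> ratfun K} := (@tofrac {poly K} \o polyC)%FUN.
have := h; rewrite -(fmorph_eq0 f); congr (_ != _).
have fz k : f k%:~R = k%:~R by exact: rmorph_int.
by rewrite !rmorphD !rmorphM !fz.
Qed.

Lemma nonresonant_par (R : realType) :
  nonresonant (par R 0) (par R 1) (par R 2) (par R 3).
Proof.
move=> k0 k1 k2 k3 m k2n0.
pose X k : {mpoly R[i][4]} := 'X_(inord k).
have -> : k0%:~R * par R 0 + k1%:~R * par R 1 + k2%:~R * par R 2 +
    k3%:~R * par R 3 + m%:~R =
  (* A linear form in the indeterminates is non-zero because its coefficient at A_2 is [k2],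
     non-zero in characteristic 0. *)
  tofrac (X 0%N *~ k0 + X 1%N *~ k1 + X 2%N *~ k2 + X 3%N *~ k3 + m%:~R).
  by rewrite !rmorphD !rmorphMz rmorph1 /par !mulrzl.
rewrite tofrac_eq0; apply/eqP=> /(congr1 (mcoeff U_(inord 2))).
rewrite !mcoeffD !raddfMz /= !mcoeffX mcoeff1 mcoeff0 !eq_mnm1 mnm1_eq0.
rewrite -!val_eqE /= !inordK //= !mul0rz !add0r !addr0.
by move/eqP; rewrite intr_eq0 (negPf k2n0).
Qed.

(** * Paths between points of the even lattice *)

Section Lattice.
Variables (F : fieldType) (der : F -> F).
Hypothesis derD : forall f g, der (f + g) = der f + der g.
Hypothesis derM : forall f g, der (f * g) = der f * g + f * der g.
Variable x : F.
Hypothesis derx : der x = 1.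
Hypotheses (x_neq0 : x != 0) (x1_neq0 : x - 1 != 0).
Variables A0 A1 A2 A3 : F.
Hypotheses (d0 : der A0 = 0) (d1 : der A1 = 0).
Hypotheses (d2 : der A2 = 0) (d3 : der A3 = 0).
Hypothesis nr : nonresonant A0 A1 A2 A3.

Let two_neq0 : 2 != 0 :> F.
Proof.
(* The form 2 A2 does not vanish, hence neither does 2. *)
have := nr 0 0 0 0 (isT : 2 != 0 :> int).
by rewrite !mul0r !add0r !addr0 mulf_eq0 negb_or => /andP[].
Qed.

Let E (n0 n1 n2 n3 : int) : diffop F :=
  Z3 x (A0 + n0%:~R) (A1 + n1%:~R) (A2 + n2%:~R) (A3 + n3%:~R).
Let iso := diffop_iso der.

Let der_shift A n : der A = 0 -> der (A + n%:~R) = 0.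
Proof.
move=> dA; rewrite derD dA add0r.
by case: n => n; rewrite ?NegzE ?mulrNz ?derN // ?(der_nat derD derM) // oppr0.
Qed.

Let der_opp A : der A = 0 -> der (- A) = 0.
Proof. by move=> dA; rewrite derN // dA oppr0. Qed.

Let E_neq0 n0 n1 n2 n3 : E n0 n1 n2 n3 != 0.
Proof. by rewrite -size_poly_eq0 size_Z3. Qed.

Let nrE n0 n1 n2 n3 := nonresonant_shift n0 n1 n2 n3 nr.

Let step0 n0 n1 n2 n3 : iso (E n0 n1 n2 n3) (E (n0 - 1) n1 (n2 - 1) n3).
Proof.
rewrite /iso /E !intrB !addrA.
apply: Z3_lower0 => //; try exact: der_shift.
exact: step_factor_neq0 (nrE _ _ _ _).
Qed.

(** Raising A0 is lowering -A0, and Z3 is even in A0. *)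
Let step0' n0 n1 n2 n3 : iso (E n0 n1 n2 n3) (E (n0 + 1) n1 (n2 - 1) n3).
Proof.
rewrite /iso /E !intrB !intrD !addrA -Z3_opp0 -[X in _ X]Z3_opp0.
rewrite [- (_ + 1%:~R)]opprD.
apply: Z3_lower0 => //; try (try apply: der_opp; exact: der_shift).
exact: step_factor_neq0 (nonresonant_opp0 (nrE _ _ _ _)).
Qed.

Let step1' n0 n1 n2 n3 : iso (E n0 n1 n2 n3) (E n0 (n1 + 1) (n2 - 1) n3).
Proof.
rewrite /iso /E !intrB !intrD !addrA -Z3_opp1 -[X in _ X]Z3_opp1.
rewrite [- (_ + 1%:~R)]opprD.
apply: Z3_lower1 => //; try (try apply: der_opp; exact: der_shift).
apply: step_factor_neq0.
exact: nonresonant_opp0 (nonresonant_swap01 (nrE _ _ _ _)).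
Qed.

Let step3' n0 n1 n2 n3 : iso (E n0 n1 n2 n3) (E n0 n1 (n2 - 1) (n3 + 1)).
Proof.
rewrite /iso /E !intrB !intrD !addrA -Z3_opp3 -[X in _ X]Z3_opp3.
rewrite [- (_ + 1%:~R)]opprD.
apply: Z3_lower3 => //; try (try apply: der_opp; exact: der_shift).
apply: step_factor_neq0.
exact: nonresonant_opp0 (nonresonant_swap03 (nonresonant_swap01 (nrE _ _ _ _))).
Qed.

Let chain := diffop_iso_chain derD derM.
Let trans := @diffop_iso_trans _ _ derD derM.

(** The path uses e_0 - e_2, e_1 - e_2 and e_3 - e_2 to reach the right n0, n1 and n3; what is
    missing in the A2 direction is then n0 + n1 + n2 + n3, an even number. *)
Lemma Z3_even_shift_iso n0 n1 n2 n3 : (2 %| n0 + n1 + n2 + n3)%Z ->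
  diffop_iso der (Z3 x A0 A1 A2 A3)
    (Z3 x (A0 + n0%:~R) (A1 + n1%:~R) (A2 + n2%:~R) (A3 + n3%:~R)).
Proof.
case/dvdzP=> k nk.
have e0 : iso (E 0 0 0 0) (E n0 0 (- n0) 0).
  apply: (chain (E := fun j => E j 0 (- j) 0)) => // j.
  by rewrite opprD; exact: step0'.
have e1 : iso (E n0 0 (- n0) 0) (E n0 n1 (- n0 - n1) 0).
  rewrite -{1}[- n0]subr0; apply: (chain (E := fun j => E n0 j (- n0 - j) 0)).
    by [].
  by move=> j; rewrite opprD addrA; exact: step1'.
have e3 : iso (E n0 n1 (- n0 - n1) 0) (E n0 n1 (- n0 - n1 - n3) n3).
  rewrite -{1}[- n0 - n1]subr0.
  apply: (chain (E := fun j => E n0 n1 (- n0 - n1 - j) j)) => // j.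
  by rewrite opprD addrA; exact: step3'.
have e2 : iso (E n0 n1 (- n0 - n1 - n3) n3) (E n0 n1 n2 n3).
  have -> : n2 = - n0 - n1 - n3 + k * 2 by rewrite -nk; ring.
  rewrite -{1}[- n0 - n1 - n3]addr0 -(mul0r 2).
  apply: (chain (E := fun j => E n0 n1 (- n0 - n1 - n3 + j * 2) n3)) => // j.
  (* Read backwards, the step by 2 e_2 is -e_0 - e_2 followed by e_0 - e_2. *)
  apply: diffop_iso_sym => //.
  apply: (trans (step0 _ _ _ _)).
  set c := (X in E _ _ X _).
  rewrite (_ : _ + j * 2 = c - 1); last by rewrite /c; ring.
  by rewrite -[X in E X _ (c - 1)](subrK 1); exact: step0'.
have : iso (E 0 0 0 0) (E n0 n1 n2 n3).
  exact: trans (trans (trans e0 e1) e3) e2.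
by rewrite /iso /E !addr0.
Qed.

End Lattice.

Theorem theorem3p2 (R : realType) (n0 n1 n2 n3 : int)
    (even_shift : (2 %| n0 + n1 + n2 + n3)%Z) :
  let x := ratX (parfield R) in
  let A k := ratC (par R k) in
  exists P : diffop (ratfun (parfield R)),
    shift_operator (@rderiv (parfield R))
      (Z3 x (A 0%N) (A 1%N) (A 2%N) (A 3%N))
      (Z3 x (A 0%N + n0%:~R) (A 1%N + n1%:~R)
            (A 2%N + n2%:~R) (A 3%N + n3%:~R))
      P.
Proof.
move=> x A.
have x0 : x != 0 by rewrite tofrac_eq0 polyX_eq0.
have x1 : x - 1 != 0 by rewrite -[1]tofrac1; exact: ratX_subC_neq0.
have nr := nonresonant_ratC (@nonresonant_par R).
apply: (diffop_iso_shift_operator (@rderivD _) (@rderivM _)).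
  exact: size_Z3.
apply: (Z3_even_shift_iso (@rderivD _) (@rderivM _)) => //;
  first exact: rderiv_ratX; exact: rderiv_ratC.
Qed.
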